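(* $$\operatorname{gr}_4(P_5:PA_{6,5})=24 .$$
   Context: All graphs are finite, simple and undirected. $K_n$ is the complete graph on $n$ vertices and $P_5$ is the path with $5$ vertices and $4$ edges. For $t\geq\omega+1$, the pineapple $PA_{t,\omega}$ is the graph of order $t$ obtained from the complete graph $K_\omega$ by attaching $t-\omega$ pendent vertices to one and the same vertex of $K_\omega$; thus $PA_{6,5}$ is $K_5$ with one pendent vertex attached. A $k$-edge-coloring assigns to each edge one of $k$ colors; all $k$-edge-colorings are assumed exact, i.e. each of the $k$ colors is used at least once. An edge-colored graph is rainbow if all its edges have different colors and monochromatic if all its edges have a single color. A copy of a graph means a (not necessarily induced) subgraph isomorphic to it. For non-empty graphs $G,H$ (graphs with at least one edge) and a positive integer $k$, the Gallai-Ramsey number $\operatorname{gr}_k(G:H)$ is the minimum integer $N$ with $\binom{N}{2}\geq k$ (so that $K_N$ admits a $k$-edge-coloring) such that for all $n\geq N$, every $k$-edge-coloring of $K_n$ contains either a rainbow copy of $G$ or a monochromatic copy of $H$. *)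

(* Defs.v *)
From mathcomp Require Import all_boot.

Set Implicit Arguments.
Unset Strict Implicit.
Unset Printing Implicit Defensive.

Record sgraph := SGraph {
  vertex :> finType;
  adj : rel vertex;
  adj_sym : symmetric adj;
  adj_irr : irreflexive adj }.

Definition edges (G : sgraph) : {set {set G}} :=
  [set e : {set G} | [exists x : G, exists y : G, adj x y && (e == [set x; y])]].

Definition complete_rel n : rel 'I_n := fun x y => x != y.

Fact complete_sym n : symmetric (@complete_rel n).
Proof. by move=> x y; rewrite /complete_rel eq_sym. Qed.

Fact complete_irr n : irreflexive (@complete_rel n).
Proof. by move=> x; rewrite /complete_rel eqxx. Qed.

Definition complete_graph n : sgraph :=
  SGraph (@complete_sym n) (@complete_irr n).

(* [path_graph n] has n vertices, hence n - 1 edges. *)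
Definition path_rel n : rel 'I_n :=
  fun x y => (x.+1 == y :> nat) || (y.+1 == x :> nat).

Fact path_rel_sym n : symmetric (@path_rel n).
Proof. by move=> x y; rewrite /path_rel orbC. Qed.

Fact path_rel_irr n : irreflexive (@path_rel n).
Proof. by move=> x; rewrite /path_rel orbb gtn_eqF. Qed.

Definition path_graph n : sgraph := SGraph (@path_rel_sym n) (@path_rel_irr n).

(* The vertices smaller than w form the clique; the t - w remaining ones are
   pendent, all attached to vertex 0.  Meaningful for 0 < w < t. *)
Definition pineapple_rel t w : rel 'I_t := fun x y =>
  (x != y) && [|| (x < w) && (y < w),
                  (x == 0 :> nat) && (w <= y)
                | (y == 0 :> nat) && (w <= x)].

Fact pineapple_sym t w : symmetric (@pineapple_rel t w).
Proof.
move=> x y; rewrite /pineapple_rel eq_sym [(x < w) && _]andbC.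
by rewrite [X in _ || X]orbC.
Qed.

Fact pineapple_irr t w : irreflexive (@pineapple_rel t w).
Proof. by move=> x; rewrite /pineapple_rel eqxx. Qed.

Definition pineapple t w : sgraph :=
  SGraph (@pineapple_sym t w) (@pineapple_irr t w).

(* A coloring is a function on all vertex sets, of which only the values on
   edges are ever used; in particular exactness is asked of the edges. *)
Definition exact_coloring k (F : sgraph) (c : {set F} -> 'I_k) : Prop :=
  forall i : 'I_k, exists2 e, e \in edges F & c e = i.

(* A copy of G in F is given by an injective homomorphism f : G -> F; the
   edges of the copy are the sets f @: e for e an edge of G. *)
Definition copy_embedding (G F : sgraph) (f : G -> F) : Prop :=
  injective f /\ forall x y : G, adj x y -> adj (f x) (f y).

Definition has_rainbow_copy k (F : sgraph) (c : {set F} -> 'I_k)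
    (G : sgraph) : Prop :=
  exists2 f : G -> F, copy_embedding f &
    {in edges G &, injective (fun e : {set G} => c (f @: e))}.

Definition has_monochromatic_copy k (F : sgraph) (c : {set F} -> 'I_k)
    (H : sgraph) : Prop :=
  exists2 f : H -> F, copy_embedding f &
    exists i : 'I_k, forall e : {set H}, e \in edges H -> c (f @: e) = i.

Definition gr_bound k (G H : sgraph) (N : nat) : Prop :=
  k <= 'C(N, 2) /\
  forall n, N <= n -> forall c : {set complete_graph n} -> 'I_k,
    exact_coloring c -> has_rainbow_copy c G \/ has_monochromatic_copy c H.

(* gr_k(G : H) = N; a relation, since the minimum is not known a priori to
   exist. *)
Definition is_gallai_ramsey k (G H : sgraph) (N : nat) : Prop :=
  gr_bound k G H N /\ forall M, gr_bound k G H M -> N <= M.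

(* Main.v *)
Require Import Defs.
From mathcomp Require Import all_boot zify.
From Stdlib Require Import Classical_Prop.

Set Implicit Arguments.
Unset Strict Implicit.
Unset Printing Implicit Defensive.

(* Let a 4-coloring of K_n, n >= 24, have no rainbow P_5.  If some vertex v sees
   three colors, then v, one neighbor in each of these colors and an edge of the
   fourth color lie in a set S of six vertices, and a search through the
   colorings of K_8 shows that every edge disjoint from S has the color which is
   most frequent inside S; hence K_n - S is monochromatic.  Otherwise every
   vertex sees at most two colors, and as these sets of colors pairwise meet, a
   color q belongs to all of them.  The vertices seeing the other colors j then
   form disjoint sets V_j joined in color q.  Without monochromatic pineapple,
   V_j contains a q-clique of size 2 if |V_j| >= 6 and of size 3 if |V_j| >= 14
   (by R(3, 5) <= 14); these cliques and the vertices seeing only q together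
   form a q-clique of size at least 5.  The bound 13 + 5 + 5 of this count is
   attained by the lower bound coloring of K_23. *)

(** * Paths and the colors along them *)

Definition path_colors (T C : Type) (c : T -> T -> C) (s : seq T) : seq C :=
  if s is x :: s' then pairmap c x s' else [::].

Lemma path_colors_rcons (T C : Type) (c : T -> T -> C) (s : seq T) x y :
  path_colors c (rcons (rcons s x) y) = rcons (path_colors c (rcons s x)) (c x y).
Proof.
case: s => [|z s] //=.
by rewrite -!cats1 !pairmap_cat /= last_cat /=.
Qed.

Lemma path_colors_rev (T C : Type) (c : T -> T -> C) (s : seq T) :
  (forall x y, c x y = c y x) -> path_colors c (rev s) = rev (path_colors c s).
Proof.
move=> csym; elim: s => [|x [|y s] IH] //.
by rewrite 2!rev_cons path_colors_rcons -rev_cons IH csym -rev_cons.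
Qed.

Lemma path_colors_map (T U C D : Type) (c : T -> T -> C) (g : C -> D)
    (h : U -> T) (s : seq U) :
  path_colors (fun i j => g (c (h i) (h j))) s = map g (path_colors c (map h s)).
Proof. by case: s => //= x s; elim: s x => //= y s IH x; rewrite IH. Qed.

Definition has_rainbow_path (T C : eqType) (c : T -> T -> C) : Prop :=
  exists s : seq T, [/\ size s = 5, uniq s & uniq (path_colors c s)].

(** * Exhaustive search over the colorings of eight vertices *)

(** A matrix indexed by vertices; an entry out of range reads as [None], so the empty list is the
    uncolored graph. *)
Definition partial_coloring := seq (seq (option nat)).

Definition color_of (m : partial_coloring) u w : option nat :=
  nth None (nth [::] m u) w.

Definition set_color (m : partial_coloring) u w x : partial_coloring :=
  let put m u w := set_nth [::] m u (set_nth None (nth [::] m u) w (Some x)) in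
  put (put m u w) w u.

Definition extends (f : nat -> nat -> nat) (m : partial_coloring) : Prop :=
  forall u w x, color_of m u w = Some x -> f u w = x.

Lemma extends_set_color f m u w x : (forall i j, f i j = f j i) ->
  extends f m -> f u w = x -> extends f (set_color m u w x).
Proof.
move=> fsym fm fuw.
have put k a b : extends f k -> f a b = x ->
    extends f (set_nth [::] k a (set_nth None (nth [::] k a) b (Some x))).
  move=> fk fab i j y; rewrite /color_of nth_set_nth /=.
  case: (eqVneq i a) => [->|_]; last exact: fk.
  rewrite nth_set_nth /=; case: (eqVneq j b) => [->|_]; last exact: fk.
  by case=> <-.
by apply: (put); [apply: (put)|rewrite fsym].
Qed.

(* Written with [eqn] and nested [if]s, and so without eager evaluation of both
   arguments of a connective, because the search below is run by the kernel. *)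
Fixpoint memn (x : nat) (s : seq nat) : bool :=
  if s is y :: s' then if eqn x y then true else memn x s' else false.

Lemma memnE x s : memn x s = (x \in s).
Proof. by elim: s => //= y s IH; rewrite inE -IH eqnE; case: eqP. Qed.

(* The vertices of a path, last reached first, and the colors of its edges. *)
Definition colored_path := (seq nat * seq nat)%type.

(** The path grows at its head and is handed to the continuation [P]; nested calls enumerate longer
    rainbow paths. *)
Definition can_extend (m : partial_coloring) (P : colored_path -> bool)
    (p : colored_path) : bool :=
  has (fun w => if memn w p.1 then false else
         if color_of m (head 0 p.1) w is Some x then
           if memn x p.2 then false else P (w :: p.1, x :: p.2)
         else false) (iota 0 8).

(* Up to reversal, the edge [u w] is the first or the second edge of a path on
   five vertices. *)
Definition rainbow_through (m : partial_coloring) u w x : bool :=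
  let ext := can_extend m in
  let yes (p : colored_path) := true in
  let flip (p : colored_path) := (rev p.1, rev p.2) in
  let from_end p := ext (ext (ext yes)) p in
  let from_middle p := ext (fun q => ext (ext yes) (flip q)) p in
  let p := ([:: u; w], [:: x]) in
  let q := ([:: w; u], [:: x]) in
  if from_end p then true else if from_end q then true else
  if from_middle p then true else from_middle q.

Definition rainbow_path_of (f : nat -> nat -> nat) (p : colored_path) : Prop :=
  [/\ all (gtn 8) p.1, uniq p.1, p.2 = path_colors f p.1 & uniq p.2].

Lemma can_extend_sound f m P p : (forall i j, f i j = f j i) -> extends f m ->
  0 < size p.1 -> rainbow_path_of f p -> can_extend m P p ->
  exists q, [/\ size q.1 = (size p.1).+1, rainbow_path_of f q & P q].
Proof.
case: p => [[|u s] cs] //= fsym fm _ [/= s8 us -> ucs] /hasP[w].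
rewrite mem_iota => w8 /=; rewrite eqnE memnE.
case: ifPn => // /norP[wu wus].
case E: color_of => [x|] //; rewrite memnE; case: ifPn => // xcs Pq.
exists (w :: u :: s, x :: pairmap f u s); split=> //; split=> //=.
- by rewrite s8 andbT.
- by rewrite inE negb_or wu wus.
- by rewrite fsym (fm _ _ _ E).
- by rewrite xcs.
Qed.

Definition rainbow8 (f : nat -> nat -> nat) : Prop :=
  exists s, [/\ size s = 5, all (gtn 8) s, uniq s & uniq (path_colors f s)].

Lemma rainbow_through_sound f m u w x : (forall i j, f i j = f j i) ->
  extends f m -> u < 8 -> w < 8 -> u != w -> f u w = x ->
  rainbow_through m u w x -> rainbow8 f.
Proof.
move=> fsym fm u8 w8 uw fuw.
have ext P p := @can_extend_sound f m P p fsym fm.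
have fin2 (p : colored_path) : size p.1 = 3 -> rainbow_path_of f p ->
    can_extend m (can_extend m (fun=> true)) p -> rainbow8 f.
  move=> sp rp /(ext _ _ _ rp)[|q [sq rq /(ext _ _ _ rq)[|r [sr rr _]]]];
    rewrite ?sp ?sq //.
  case: rr => r8 ur cr ucr; exists r.1; split=> //; last by rewrite -cr.
  by rewrite sr sq sp.
have start a b : a < 8 -> b < 8 -> a != b -> f a b = x ->
    rainbow_path_of f ([:: a; b], [:: x]).
  by move=> a8 b8 ab fab; split; rewrite /= ?inE ?a8 ?b8 ?ab ?fab.
have ends a b : rainbow_path_of f ([:: a; b], [:: x]) ->
    can_extend m (can_extend m (can_extend m (fun=> true))) ([:: a; b], [:: x]) ->
    rainbow8 f.
  by move=> rp /(ext _ _ _ rp)[//|q [sq rq eq]]; apply: fin2 eq.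
(* One extension and a reversal put the given edge second; two extensions at the other end complete
   the path. *)
have middle a b : rainbow_path_of f ([:: a; b], [:: x]) ->
    can_extend m (fun q => can_extend m (can_extend m (fun=> true))
                             (rev q.1, rev q.2)) ([:: a; b], [:: x]) ->
    rainbow8 f.
  move=> rp /(ext _ _ _ rp)[//|q [sq rq eq]]; apply: fin2 eq; rewrite ?size_rev //.
  case: rq => q8 uq cq ucq; split=> /=; rewrite ?all_rev ?rev_uniq //.
  by rewrite path_colors_rev // -cq.
have uwx := start u w u8 w8 uw fuw.
have wux : rainbow_path_of f ([:: w; u], [:: x]).
  by apply: start; rewrite // 1?eq_sym // fsym.
rewrite /rainbow_through /=.
case: ifP => [+ _|_]; first exact: ends.
case: ifP => [+ _|_]; first exact: ends.
by case: ifP => [+ _|_]; exact: middle.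
Qed.

(** Ordering by the larger endpoint lets the search fill growing initial segments of the vertices,
    so that rainbow paths prune it early. *)
Definition pairs n : seq (nat * nat) := [seq (i, j) | j <- iota 0 n, i <- iota 0 j].

(* The last edge, 67, may only get a color covering at least 8 of the 15 edges
   inside {0, ..., 5}; at most one color does so. *)
Fixpoint search (es : seq (nat * nat)) (m : partial_coloring) : bool :=
  if es is e :: es' then
    all (fun x => let m' := set_color m e.1 e.2 x in
           if rainbow_through m' e.1 e.2 x then true else search es' m') (iota 0 4)
  else
    all (fun x =>
           if 8 <= count (fun p => if color_of m p.1 p.2 is Some y then eqn x y
                                   else false) (pairs 6)
           then true else rainbow_through (set_color m 6 7 x) 6 7 x) (iota 0 4).

(** The branch following the actual colors of [f] is never pruned, since pruning exhibits a rainbow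
    path. At its end the pairs counted in [m] are among those counted for [f]. *)
Lemma search_sound f es m : (forall i j, f i j = f j i) ->
  (forall i j, f i j < 4) -> ~ rainbow8 f ->
  all (fun e => [&& e.1 < 8, e.2 < 8 & e.1 != e.2]) es ->
  extends f m -> search es m ->
  8 <= count (fun p => f 6 7 == f p.1 p.2) (pairs 6).
Proof.
move=> fsym f4 norb; elim: es m => [|e es IH] m.
  move=> _ fm /allP/(_ (f 6 7)); rewrite mem_iota f4 => /(_ isT).
  case: ifP => [c8 _|_ /rainbow_through_sound rb].
    apply: leq_trans c8 (sub_count _ _) => -[i j] /=.
    by case E: color_of => [y|] //; rewrite eqnE (fm _ _ _ E).
  by case: norb; apply: rb => //; apply: extends_set_color.
rewrite [all _ (e :: es)]/= => /andP[/and3P[e8 e8' ne] es8] fm /allP/(_ (f e.1 e.2)).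
rewrite mem_iota f4 => /(_ isT); cbv zeta.
have fm' : extends f (set_color m e.1 e.2 (f e.1 e.2)).
  exact: extends_set_color.
case: ifP => [rb _|_]; last exact: IH.
by case: norb; apply: rainbow_through_sound rb.
Qed.

(* Vertex 0 sees three colors on the edges to 1, 2, 3, and [e] has the fourth. *)
Definition start (e : nat * nat) : seq (nat * nat) :=
  [:: (0, 1); (0, 2); (0, 3); e].

(** Up to permuting the leaves and the outer vertices, these are the positions left for an edge of
    the fourth color: center to outside, leaf to leaf, leaf to outside, off the star. *)
Definition fourth_edges : seq (nat * nat) := [:: (0, 4); (1, 2); (1, 4); (4, 5)].

Lemma search_succeeds :
  all (fun e => search [seq p <- pairs 8 | p \notin (6, 7) :: start e]
         (set_color (set_color (set_color (set_color [::] 0 1 0) 0 2 1) 0 3 2)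
            e.1 e.2 3)) fourth_edges.
Proof. by vm_compute. Qed.

Lemma majority_color f e : e \in fourth_edges ->
  (forall i j, f i j = f j i) -> (forall i j, f i j < 4) -> ~ rainbow8 f ->
  [seq f p.1 p.2 | p <- start e] = [:: 0; 1; 2; 3] ->
  8 <= count (fun p => f 6 7 == f p.1 p.2) (pairs 6).
Proof.
move=> eF fsym f4 norb [f01 f02 f03 fe].
have /allP/(_ e eF) := search_succeeds; apply: search_sound => //.
  apply/allP=> p; rewrite mem_filter => /andP[_]; move: p; apply/allP.
  by vm_compute.
do 4! apply: extends_set_color => //.
by move=> u w x; rewrite /color_of !nth_nil.
Qed.

(** * The edges disjoint from six vertices that carry all colors *)

Lemma mem_uniq_full (T : finType) (s : seq T) x :
  uniq s -> size s = #|T| -> x \in s.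
Proof.
move=> us sT; have /subset_cardP : #|s| = #|T| by rewrite (card_uniqP us).
by rewrite subset_predT => /(_ isT) ->.
Qed.

(** The color of an edge outside [S] is taken by at least 8 of the 15 pairs inside [S]; for two such
    edges these pairs overlap, so the colors agree. *)
Lemma mono_outside (T : eqType) (c : T -> T -> 'I_4) (S : seq T) v0 e :
  (forall x y, c x y = c y x) -> ~ has_rainbow_path c ->
  size S = 6 -> uniq S -> e \in fourth_edges ->
  uniq [seq c (nth v0 S p.1) (nth v0 S p.2) | p <- start e] ->
  forall x y x' y', x \notin S -> y \notin S -> x' \notin S -> y' \notin S ->
  x != y -> x' != y' -> c x y = c x' y'.
Proof.
move=> csym norb sS uS eF uc.
set ks := map _ _ in uc; have sks : size ks = 4 by rewrite size_map.
have in_ks k : k \in ks by apply: mem_uniq_full; rewrite // sks card_ord.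
(* Colors are renamed by their position in [ks], so that the edges of [start e] get 0, 1, 2, 3 as
   the search assumes. *)
pose col x y := index (c x y) ks.
have major x y : x \notin S -> y \notin S -> x != y ->
    8 <= count (fun p => col x y == col (nth v0 S p.1) (nth v0 S p.2)) (pairs 6).
  move=> xS yS xy; set V := S ++ [:: x; y].
  have sV : size V = 8 by rewrite size_cat sS.
  have uV : uniq V by rewrite cat_uniq uS /= !inE xy (negPf xS) (negPf yS).
  have nthV i : i < 6 -> nth v0 V i = nth v0 S i by rewrite nth_cat sS => ->.
  have := @majority_color (fun i j => col (nth v0 V i) (nth v0 V j)) e eF.
  have -> : nth v0 V 6 = x by rewrite nth_cat sS.
  have -> : nth v0 V 7 = y by rewrite nth_cat sS.
  have eq6 g h : {in pairs 6, forall p, g p = h p :> bool} ->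
    count g (pairs 6) = count h (pairs 6) by move=> /eq_in_count.
  rewrite (eq6 _ (fun p => col x y == col (nth v0 S p.1) (nth v0 S p.2))); last first.
    have p6 : all (fun p => (p.1 < 6) && (p.2 < 6)) (pairs 6) by [].
    by move=> p /(allP p6)/andP[p1 p2]; rewrite !nthV.
  apply.
  - by move=> i j; rewrite /col csym.
  - by move=> i j; rewrite /col -[X in _ < X]sks index_mem.
  - case=> s [s5 s8 us ucs]; case: norb; exists (map (nth v0 V) s).
    rewrite size_map; split=> //.
      rewrite map_inj_in_uniq // => i j /(allP s8) i8 /(allP s8) j8 /eqP.
      by rewrite nth_uniq ?sV // => /eqP.
    move: ucs.
    by rewrite (path_colors_map c (index^~ ks) (nth v0 V)) => /map_uniq.
  - have -> : [seq col (nth v0 V p.1) (nth v0 V p.2) | p <- start e]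
            = [seq index k ks | k <- ks].
      rewrite /ks -map_comp; apply/eq_in_map=> p pe /=; rewrite /col !nthV //.
        move: p pe; apply/allP; move: e eF {uc ks sks in_ks col}; apply/allP.
        by vm_compute.
      move: p pe; apply/allP; move: e eF {uc ks sks in_ks col}; apply/allP.
      by vm_compute.
    apply: (@eq_from_nth _ 0); rewrite size_map sks // => i i4.
    rewrite (nth_map (c v0 v0)) ?sks // index_uniq ?sks //.
    by case: i i4 => [|[|[|[|]]]].
move=> x y x' y' xS yS x'S y'S xy x'y'.
pose a p := col x y == col (nth v0 S p.1) (nth v0 S p.2).
pose b p := col x' y' == col (nth v0 S p.1) (nth v0 S p.2).
have : has (predI a b) (pairs 6).
  have a8 : 8 <= count a (pairs 6) by exact: major.
  have b8 : 8 <= count b (pairs 6) by exact: major.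
  rewrite has_count -(ltn_add2l (count (predU a b) (pairs 6))) count_predUI addn0.
  apply: leq_ltn_trans (count_size _ _) _.
  exact: leq_trans (leq_add a8 b8).
case/hasP=> p _ /andP[/eqP ea /eqP eb].
rewrite -(nth_index (c x y) (in_ks (c x y))) -(nth_index (c x y) (in_ks (c x' y'))).
by rewrite -/(col x y) ea -eb.
Qed.

(** * Monochromatic cliques and pineapples *)

Definition mono_clique (T : finType) (C : eqType) (c : T -> T -> C) (k : C)
    (Q : {set T}) : Prop := {in Q &, forall x y, x != y -> c x y = k}.

Definition has_mono_pineapple (T : finType) (C : eqType) (c : T -> T -> C) : Prop :=
  exists k (Q : {set T}) u w,
    [/\ #|Q| = 5, mono_clique c k Q, u \in Q, w \notin Q & c u w = k].

Lemma subset_of_card (T : finType) (A : {set T}) n : n <= #|A| ->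
  exists2 B : {set T}, B \subset A & #|B| = n.
Proof.
move=> nA; exists [set x in take n (enum A)].
  by apply/subsetP=> x; rewrite inE => /mem_take; rewrite mem_enum.
rewrite cardsE (card_uniqP _) ?take_uniq ?enum_uniq // size_takel //.
by rewrite -cardE.
Qed.

Lemma mono_clique_sub (T : finType) (C : eqType) (c : T -> T -> C) k (Q P : {set T}) :
  P \subset Q -> mono_clique c k Q -> mono_clique c k P.
Proof. by move=> /subsetP PQ cQ x y /PQ xQ /PQ yQ; apply: cQ. Qed.

Lemma pineapple_of_clique6 (T : finType) (C : eqType) (c : T -> T -> C) k (Q : {set T}) :
  mono_clique c k Q -> 5 < #|Q| -> has_mono_pineapple c.
Proof.
move=> cQ Q6; have [P PQ P5] := subset_of_card (ltnW Q6).
have /properP[_ [w wQ wP]] : P \proper Q by rewrite properEcard PQ P5.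
have /card_gt0P[u uP] : 0 < #|P| by rewrite P5.
exists k, P, u, w; split=> //; first exact: mono_clique_sub PQ cQ.
apply: cQ => //; first exact: (subsetP PQ).
by apply: contraNneq wP => <-.
Qed.

(** * Triangle-free graphs and the bound R(3, 5) <= 14 *)

Section TriangleFree.

Variables (T : finType) (e : rel T).
Hypothesis esym : symmetric e.

Definition triangle_free (A : {set T}) : Prop :=
  {in A & &, forall x y z, x != y -> y != z -> x != z ->
     e x y -> e y z -> e x z -> False}.

Definition independent (I : {set T}) : Prop :=
  {in I &, forall x y, x != y -> ~~ e x y}.

(** The bound R(3, [k]) <= [n] for the graph [e], over all subsets of [T] so that it applies to sets
    of non-neighbors. *)
Definition ramsey3 k n : Prop := forall A : {set T},
  n <= #|A| -> triangle_free A ->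
  exists I : {set T}, [/\ I \subset A, #|I| = k & independent I].

Let nbrs (A : {set T}) x := [set y in A | (x != y) && e x y].
Let non_nbrs (A : {set T}) x := [set y in A | (x != y) && ~~ e x y].

Lemma triangle_free_sub (A B : {set T}) :
  B \subset A -> triangle_free A -> triangle_free B.
Proof. by move=> /subsetP BA tA x y z /BA xA /BA yA /BA zA; apply: tA. Qed.

Lemma independent_sub (A B : {set T}) :
  B \subset A -> independent A -> independent B.
Proof. by move=> /subsetP BA tA x y /BA xA /BA yA; apply: tA. Qed.

Lemma card_nbrs (A : {set T}) x : x \in A -> #|A| = (#|nbrs A x| + #|non_nbrs A x|).+1.
Proof.
move=> xA; rewrite (cardsD1 x A) xA add1n -(cardsID (nbrs A x) (A :\ x)).
congr (_ + _).+1; apply: eq_card => y; rewrite !inE [y == x]eq_sym;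
  by case: (x == y); case: (y \in A); case: (e x y).
Qed.

Lemma independent_nbrs (A : {set T}) x :
  triangle_free A -> x \in A -> independent (nbrs A x).
Proof.
move=> tA xA y z; rewrite !inE => /and3P[yA xy exy] /and3P[zA xz exz] yz.
by apply/negP => eyz; apply: (tA x y z).
Qed.

Lemma ramsey3_non_nbrs k n (A : {set T}) x : ramsey3 k n -> triangle_free A ->
  x \in A -> n <= #|non_nbrs A x| ->
  exists I : {set T}, [/\ I \subset A, #|I| = k.+1 & independent I].
Proof.
move=> Rk tA xA nN; have NA : non_nbrs A x \subset A.
  by apply/subsetP=> y; rewrite inE => /andP[].
have [I [IN Ik Iind]] := Rk _ nN (triangle_free_sub NA tA).
have xI : x \notin I by apply/negP => /(subsetP IN); rewrite inE eqxx andbF.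
exists (x |: I); split.
- by rewrite subUset sub1set xA (subset_trans IN NA).
- by rewrite cardsU1 xI Ik.
have xe y : y \in I -> ~~ e x y by move=> /(subsetP IN); rewrite inE => /and3P[].
move=> y z /setU1P[->|yI] /setU1P[->|zI]; rewrite ?eqxx //.
- by move=> _; exact: xe.
- by move=> _; rewrite esym; exact: xe.
exact: Iind.
Qed.

Lemma ramsey3_nbrs k (A : {set T}) x : triangle_free A ->
  x \in A -> k <= #|nbrs A x| ->
  exists I : {set T}, [/\ I \subset A, #|I| = k & independent I].
Proof.
move=> tA xA /subset_of_card[I IN Ik]; exists I; split=> //.
  by apply: subset_trans IN _; apply/subsetP=> y; rewrite inE => /andP[].
exact: independent_sub IN (independent_nbrs tA xA).
Qed.

(** More than [k] neighbors of a vertex contain the independent set; otherwise at least [n]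
    non-neighbors remain. *)
Lemma ramsey3S k n : ramsey3 k n -> ramsey3 k.+1 (n + k.+1).
Proof.
move=> Rk A nA tA; have /card_gt0P[x xA] : 0 < #|A| by lia.
have [|few] := leqP k.+1 #|nbrs A x|; first exact: ramsey3_nbrs.
by apply: (ramsey3_non_nbrs Rk tA xA); have := card_nbrs xA; lia.
Qed.

Lemma handshake (A : {set T}) : ~~ odd (\sum_(x in A) #|nbrs A x|).
Proof.
pose f x y : nat := (x != y) && e x y.
have -> : \sum_(x in A) #|nbrs A x| = \sum_(x in A) \sum_(y in A) f x y.
  by apply: eq_bigr => x _; rewrite -sum1dep_card big_mkcondr.
have fsym x y : f x y = f y x by rewrite /f eq_sym esym.
(* Ordering the vertices splits the sum into two halves, equal by symmetry. *)
pose lt (x y : T) := enum_rank x < enum_rank y.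
have -> : \sum_(x in A) \sum_(y in A) f x y =
    \sum_(x in A) \sum_(y in A) lt x y * f x y +
    \sum_(x in A) \sum_(y in A) lt y x * f x y.
  rewrite -big_split; apply: eq_bigr => x _; rewrite -big_split /=.
  apply: eq_bigr => y _; rewrite -mulnDl /lt /f.
  case: (eqVneq x y) => [->|xy]; first by rewrite muln0.
  have : enum_rank x != enum_rank y :> nat.
    by apply: contraNneq xy => /ord_inj/enum_rank_inj->.
  by case: ltngtP => // _ _; rewrite mul1n.
rewrite [X in _ + X]exchange_big /=.
under [X in _ + X]eq_bigr => x _ do under eq_bigr => y _ do rewrite fsym.
by rewrite oddD addbb.
Qed.

(* If neither step applies to nine vertices, the e-graph is 3-regular on them,
   against the handshake lemma. *)
Lemma ramsey34 : ramsey3 3 6 -> ramsey3 4 9.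
Proof.
move=> R3 A0 /subset_of_card[A AA0 A9] /(triangle_free_sub AA0) tA.
suff [I [IA I4 Iind]] : exists I : {set T},
    [/\ I \subset A, #|I| = 4 & independent I].
  by exists I; split=> //; apply: subset_trans IA AA0.
have [/existsP[x /andP[xA]]|/existsPn many] :=
    boolP [exists x, (x \in A) && (3 < #|nbrs A x|)]; first exact: ramsey3_nbrs.
have [/existsP[x /andP[xA]]|/existsPn few] :=
    boolP [exists x, (x \in A) && (5 < #|non_nbrs A x|)].
  exact: ramsey3_non_nbrs R3 tA xA.
have := handshake A; rewrite (eq_bigr (fun=> 3)) ?sum_nat_const ?A9 // => x xA.
by have := card_nbrs xA; have := many x; have := few x; rewrite xA A9 /=; lia.
Qed.

Lemma ramsey35 : ramsey3 5 14.
Proof.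
have R0 : ramsey3 0 0.
  move=> A _ _; exists set0; split; rewrite ?sub0set ?cards0 //.
  by move=> x y; rewrite inE.
(* The bounds for sizes 0 to 5 are 0, 1, 3, 6, 9, 14; at size 4 parity improves 10 to 9. *)
exact: (ramsey3S (ramsey34 (ramsey3S (ramsey3S (ramsey3S R0))))).
Qed.

End TriangleFree.

(** * Colorings in which one color is seen by every vertex *)

(** Here [v1], [v2], [v3] are part sizes, [s1], [s2], [s3] sizes of cliques in them, and [r] counts
    the other vertices. A total of at most 4 allows cliques 1, 1, 1 with [r] <= 1, so at most 16
    vertices, or 2, 1, 1 with [r] = 0, so at most 13 + 5 + 5. *)
Lemma part_count (v1 v2 v3 r s1 s2 s3 : nat) :
  0 < s1 -> 0 < s2 -> 0 < s3 ->
  (5 < v1 -> 1 < s1) -> (5 < v2 -> 1 < s2) -> (5 < v3 -> 1 < s3) ->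
  (13 < v1 -> 2 < s1) -> (13 < v2 -> 2 < s2) -> (13 < v3 -> 2 < s3) ->
  24 <= v1 + v2 + v3 + r -> 4 < s1 + s2 + s3 + r.
Proof.
move=> p1 p2 p3 a1 a2 a3 b1 b2 b3.
case: (leqP s1 1) a1 b1 => [?|?]; case: (leqP s2 1) a2 b2 => [?|?];
  case: (leqP s3 1) a3 b3 => [?|?]; lia.
Qed.

Section Dominant.

Variables (T : finType) (c : T -> T -> 'I_4).
Hypothesis csym : forall x y, c x y = c y x.

Definition bicolored q j (A : {set T}) : Prop :=
  {in A &, forall x y, x != y -> c x y = q \/ c x y = j}.

Lemma mono_cliqueU k (P Q : {set T}) :
  mono_clique c k P -> mono_clique c k Q ->
  {in P & Q, forall x y, c x y = k} -> mono_clique c k (P :|: Q).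
Proof.
move=> cP cQ PQ x y /setUP[xP|xQ] /setUP[yP|yQ] xy; first exact: cP.
- exact: PQ.
- by rewrite csym; exact: PQ.
exact: cQ.
Qed.

Lemma mono_pair q j (A : {set T}) : ~ has_mono_pineapple c -> bicolored q j A ->
  5 < #|A| ->
  exists Q : {set T}, [/\ Q \subset A, mono_clique c q Q & #|Q| = 2].
Proof.
move=> noP bA A6.
have [/existsP[x /existsP[y /and4P[xA yA xy /eqP cxy]]]|/existsPn no] :=
    boolP [exists x, exists y, [&& x \in A, y \in A, x != y & c x y == q]].
  exists [set x; y]; split; last by rewrite cards2 xy.
    by rewrite subUset !sub1set xA.
  by move=> a b /set2P[]-> /set2P[]->; rewrite ?eqxx // csym.
case: noP; apply: (@pineapple_of_clique6 _ _ c j A) => // x y xA yA xy.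
case: (bA x y xA yA xy) => // cxy; have /existsPn/(_ y) := no x.
by rewrite xA yA xy cxy eqxx.
Qed.

(** If color [q] has no triangle in [A], R(3, 5) <= 14 gives a five-clique [I] of color [j]. An edge
    of color [j] leaving [I] completes a pineapple; without one, the nine or more vertices of
    [A :\: I] form a clique of color [j]. *)
Lemma mono_triangle q j (A : {set T}) : ~ has_mono_pineapple c ->
  bicolored q j A -> 13 < #|A| ->
  exists Q : {set T}, [/\ Q \subset A, mono_clique c q Q & #|Q| = 3].
Proof.
move=> noP bA A14; pose e := [rel x y | c x y == q].
have esym : symmetric e by move=> x y /=; rewrite csym.
have [/existsP[x /existsP[y /existsP[z]]]|/existsPn no] := boolP
  [exists x, exists y, exists z, [&& x \in A, y \in A, z \in A &
     [&& x != y, y != z, x != z, e x y, e y z & e x z]]].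
  case/and4P=> xA yA zA /and5P[xy yz xz /eqP cxy /andP[/eqP cyz /eqP cxz]].
  exists [set x; y; z]; split.
  - by rewrite !subUset !sub1set xA yA.
  - by move=> a b /setUP[/set2P[]|/set1P]-> /setUP[/set2P[]|/set1P]->;
      rewrite ?eqxx // csym.
  by rewrite setUC cardsU1 cards2 !inE xy [z == x]eq_sym [z == y]eq_sym
    (negPf yz) (negPf xz).
have tA : triangle_free e A.
  move=> x y z xA yA zA xy yz xz exy eyz exz.
  have /existsPn/(_ y)/existsPn/(_ z) := no x.
  by move: exy eyz exz; rewrite xA yA zA xy yz xz /= => -> -> ->.
have [I [IA I5 Iind]] := ramsey35 esym A14 tA.
case: noP.
have cI : mono_clique c j I.
  move=> x y xI yI xy; have := Iind x y xI yI xy.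
  by rewrite /=; case: (bA x y (subsetP IA x xI) (subsetP IA y yI) xy) => // ->; rewrite eqxx.
have [/existsP[u /existsP[w /and3P[uI wI /eqP cuw]]]|/existsPn noj] :=
    boolP [exists u, exists w, [&& u \in I, w \notin I & c u w == j]].
  by exists j, I, u, w.
have /card_gt0P[u uI] : 0 < #|I| by rewrite I5.
(* A vertex of [I] sees [A :\: I] entirely in color [q], so a [q]-edge inside
   [A :\: I] would give a [q]-triangle. *)
apply: (@pineapple_of_clique6 _ _ c j (A :\: I)); last first.
  by rewrite cardsD (setIidPr IA) I5; lia.
have uq w : w \in A :\: I -> (u != w) /\ e u w.
  move=> /setDP[wA wI]; have uw : u != w by apply: contraNneq wI => <-.
  split=> //; have /existsPn/(_ w) := noj u; rewrite uI wI /=.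
  by case: (bA u w (subsetP IA u uI) wA uw) => ->; rewrite eqxx.
move=> x y xAI yAI xy; have [ux eux] := uq x xAI; have [uy euy] := uq y yAI.
have [/setDP[xA _] /setDP[yA _]] := (xAI, yAI).
case: (bA x y xA yA xy) => // /eqP cxy.
by case: (tA u x y (subsetP IA u uI) xA yA ux xy uy eux cxy euy).
Qed.

Lemma mono_part q j (A : {set T}) : ~ has_mono_pineapple c -> bicolored q j A ->
  0 < #|A| ->
  exists Q : {set T}, [/\ Q \subset A, mono_clique c q Q, 0 < #|Q|,
    5 < #|A| -> 1 < #|Q| & 13 < #|A| -> 2 < #|Q|].
Proof.
move=> noP bA A0; have [A14|A13] := ltnP 13 #|A|.
  have [Q [QA cQ Q3]] := mono_triangle noP bA A14.
  by exists Q; rewrite Q3.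
have [A6|A5] := ltnP 5 #|A|.
  have [Q [QA cQ Q2]] := mono_pair noP bA A6.
  by exists Q; rewrite Q2; split=> //; lia.
have /card_gt0P[x xA] := A0.
exists [set x]; rewrite cards1; split=> //; try lia.
  by rewrite sub1set.
by move=> y z /set1P-> /set1P->; rewrite eqxx.
Qed.

Definition sees v k := [exists w, (v != w) && (c v w == k)].

Lemma seesP v w : v != w -> sees v (c v w).
Proof. by move=> vw; apply/existsP; exists w; rewrite vw eqxx. Qed.

(** The sets [V j] are disjoint and joined in color [q], and the vertices outside them see only [q];
    so [q]-cliques from the parts and all the other vertices unite to one [q]-clique. *)
Lemma dominant_pineapple q j1 j2 j3 : uniq [:: q; j1; j2; j3] ->
  (forall v w, v != w -> sees v q) ->
  (forall v i j, i != q -> j != q -> sees v i -> sees v j -> i = j) ->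
  (forall k, exists v, sees v k) -> 24 <= #|T| -> has_mono_pineapple c.
Proof.
move=> uq seesq one every T24.
apply: NNPP => noP.
pose V j := [set v | sees v j].
have col v w : v != w -> c v w = q \/ v \in V (c v w) /\ w \in V (c v w).
  move=> vw; right; rewrite !inE seesP // csym seesP //.
  by rewrite eq_sym.
have inV v w j : j != q -> v \in V j -> v != w -> c v w = q \/ c v w = j.
  move=> jq; rewrite inE => vj vw; have [->|cq] := eqVneq (c v w) q; first by left.
  by right; apply: one (seesP vw) vj.
have bV j : j != q -> bicolored q j (V j).
  by move=> jq v w vV _; apply: inV.
have cross i j v w : i != q -> j != q -> i != j -> v \in V i -> w \in V j ->
    v != w /\ c v w = q.
  move=> iq jq ij vi wj; have vw : v != w.
    apply: contraNneq ij => vw; apply/eqP; move: vi wj; rewrite !inE vw.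
    exact: one.
  split=> //; case: (inV v w i iq vi vw) => // ci; rewrite csym.
  have wv : w != v by rewrite eq_sym.
  case: (inV w v j jq wj wv) => // cj; case/eqP: ij.
  by rewrite -ci -cj csym.
have V0 j : 0 < #|V j|.
  by apply/card_gt0P; have [v vj] := every j; exists v; rewrite inE.
have : [/\ j1 != q, j2 != q, j3 != q & [&& j1 != j2, j1 != j3 & j2 != j3]].
  move: uq; rewrite /= !inE !negb_or -!andbA andbT.
  by case/and5P=> q1 q2 q3 j12 /andP[j13 j23]; rewrite !(eq_sym _ q) q1 q2 q3 j12 j13 j23.
case=> q1 q2 q3 /and3P[j12 j13 j23].
have [Q1 [S1 cQ1 Q1p Q1a Q1b]] := mono_part noP (bV j1 q1) (V0 j1).
have [Q2 [S2 cQ2 Q2p Q2a Q2b]] := mono_part noP (bV j2 q2) (V0 j2).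
have [Q3 [S3 cQ3 Q3p Q3a Q3b]] := mono_part noP (bV j3 q3) (V0 j3).
pose R := ~: (V j1 :|: V j2 :|: V j3).
have disj i j (P Q : {set T}) : i != q -> j != q -> i != j ->
    P \subset V i -> Q \subset V j -> [disjoint P & Q].
  move=> iq jq ij Pi Qj; apply/pred0P=> x /=; apply/negP=> /andP[xP xQ].
  have [] := cross i j x x iq jq ij (subsetP Pi x xP) (subsetP Qj x xQ).
  by rewrite eqxx.
have cR x y : x \in R -> x != y -> c x y = q.
  rewrite !inE !negb_or -andbA => /and3P[x1 x2 x3] xy.
  have : c x y \in [:: q; j1; j2; j3].
    by apply: mem_uniq_full; rewrite // card_ord.
  have sxy := seesP xy; rewrite !inE => /or4P[] /eqP // cxy; rewrite cxy in sxy.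
  - by rewrite sxy in x1.
  - by rewrite sxy in x2.
  - by rewrite sxy in x3.
have VR j (P : {set T}) : P \subset V j -> j \in [:: j1; j2; j3] -> [disjoint P & R].
  move=> PV jj; apply/pred0P=> x /=; apply/negP=> /andP[/(subsetP PV) xV].
  rewrite !in_setC !in_setU; move: jj xV; rewrite !inE.
  by case/or3P=> /eqP-> ->; rewrite ?orbT.
have clique12 : mono_clique c q (Q1 :|: Q2).
  apply: mono_cliqueU => // x y /(subsetP S1) x1 /(subsetP S2) y2.
  by have [] := cross _ _ _ _ q1 q2 j12 x1 y2.
have clique123 : mono_clique c q (Q1 :|: Q2 :|: Q3).
  apply: mono_cliqueU => // x y /setUP[/(subsetP S1)|/(subsetP S2)] xS /(subsetP S3) y3.
    by have [] := cross _ _ _ _ q1 q3 j13 xS y3.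
  by have [] := cross _ _ _ _ q2 q3 j23 xS y3.
have disjU (A B C : {set T}) : [disjoint A :|: B & C] =
    [disjoint A & C] && [disjoint B & C].
  by rewrite -!setI_eq0 setIUl setU_eq0.
have QR : [disjoint Q1 :|: Q2 :|: Q3 & R].
  by rewrite !disjU -andbA; apply/and3P; split; [apply: (VR j1)|apply: (VR j2)|apply: (VR j3)];
    rewrite // !inE eqxx ?orbT.
pose Q := Q1 :|: Q2 :|: Q3 :|: R.
have cQ : mono_clique c q Q.
  apply: mono_cliqueU => //; first by move=> x y xR _; apply: cR.
  move=> x y xQ yR; rewrite csym; apply: cR => //.
  by apply: contraTneq yR => ->; rewrite (disjointFr QR).
have cardU (A B : {set T}) : [disjoint A & B] -> #|A :|: B| = #|A| + #|B|.
  by rewrite cardsU -setI_eq0 => /eqP->; rewrite cards0 subn0.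
have cardQ : #|Q| = #|Q1| + #|Q2| + #|Q3| + #|R|.
  have d12 : [disjoint Q1 & Q2] by apply: (disj j1 j2).
  have d13 : [disjoint Q1 & Q3] by apply: (disj j1 j3).
  have d23 : [disjoint Q2 & Q3] by apply: (disj j2 j3).
  by rewrite !cardU // disjU d13.
have cardT : #|T| <= #|V j1| + #|V j2| + #|V j3| + #|R|.
  rewrite -(cardsC (V j1 :|: V j2 :|: V j3)) leq_add2r.
  by apply: leq_trans (leq_card_setU _ _) _; rewrite leq_add2r leq_card_setU.
have Q5 : 4 < #|Q|.
  rewrite cardQ; apply: (part_count Q1p Q2p Q3p Q1a Q2a Q3a Q1b Q2b Q3b).
  exact: leq_trans T24 cardT.
have [Q6|Qle5] := ltnP 5 #|Q|; first exact: noP (pineapple_of_clique6 cQ Q6).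
apply: noP.
(* A clique of exactly five needs a pendent vertex: if neither [x] nor [y] were joined to [w] in
   color [q], then [w] would see both [j1] and [j2]. *)
have /card_gt0P[x xQ1] := Q1p; have /card_gt0P[y yQ2] := Q2p.
have xQ : x \in Q by rewrite !inE xQ1.
have yQ : y \in Q by rewrite !inE yQ2 orbT.
have /subsetPn[w _ wQ] : ~~ ([set: T] \subset Q).
  apply/negP=> /subset_leq_card; rewrite cardsT => TQ.
  by have := leq_trans (leq_trans T24 TQ) Qle5.
have xw : x != w by apply: contraNneq wQ => <-.
have yw : y != w by apply: contraNneq wQ => <-.
have Qeq : #|Q| = 5 by apply/eqP; rewrite eqn_leq Qle5.
have [cx|cx] := inV x w j1 q1 (subsetP S1 x xQ1) xw; first by exists q, Q, x, w.
have [cy|cy] := inV y w j2 q2 (subsetP S2 y yQ2) yw; first by exists q, Q, y, w.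
case/eqP: j12; apply: (one w) => //.
  by rewrite -cx csym seesP // eq_sym.
by rewrite -cy csym seesP // eq_sym.
Qed.

End Dominant.

(** * Six-vertex frames containing all four colors *)

Lemma exists_notin (T : finType) (s : seq T) : size s < #|T| -> exists x, x \notin s.
Proof.
move=> sT; apply/existsP; apply: contraTT sT; rewrite negb_exists -leqNgt.
move=> /forallP all_in; apply: leq_trans (card_size s).
by rewrite subset_leq_card //; apply/subsetP=> x _; have := all_in x; rewrite negbK.
Qed.

Section UpperBound.

Variables (T : finType) (c : T -> T -> 'I_4).
Hypothesis csym : forall x y, c x y = c y x.
Hypothesis T24 : 24 <= #|T|.
Hypothesis norb : ~ has_rainbow_path c.
Hypothesis every : forall k, exists x y, x != y /\ c x y = k.

Lemma fresh (s : seq T) : size s < 24 -> exists x, x \notin s.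
Proof. by move=> s24; apply: exists_notin; apply: leq_trans s24 T24. Qed.

(** At least 18 vertices lie outside [S], and they form a monochromatic clique. *)
Lemma frame_pineapple (S : seq T) v0 e : size S = 6 -> uniq S ->
  e \in fourth_edges ->
  uniq [seq c (nth v0 S p.1) (nth v0 S p.2) | p <- start e] ->
  has_mono_pineapple c.
Proof.
move=> sS uS eF uc.
have [a aS] : exists a, a \notin S by apply: fresh; rewrite sS.
have [b /=] : exists b, b \notin a :: S by apply: fresh; rewrite /= sS.
rewrite inE negb_or => /andP[ba bS].
apply: (@pineapple_of_clique6 _ _ c (c b a) (~: [set x in S])).
  move=> x y; rewrite !inE => xS yS xy.
  exact: (mono_outside csym norb sS uS eF uc).
have : #|[set x in S]| <= 6 by rewrite cardsE -sS card_size.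
by have := cardsC [set x in S]; lia.
Qed.

(** New vertices are appended at the end, so the positions in [start] and [fourth_edges] keep naming
    the same vertices. *)
Lemma complete_frame (s : seq T) : uniq s -> size s <= 6 ->
  exists t, uniq (s ++ t) /\ size (s ++ t) = 6.
Proof.
elim: {s}(6 - size s) {-2}s (erefl (6 - size s)) => [|n IH] s sn us s6.
  by exists [::]; rewrite cats0; split=> //; lia.
have [x xs] : exists x, x \notin s by apply: fresh; lia.
have [|||t [ut st]] := IH (rcons s x); rewrite ?size_rcons ?rcons_uniq ?xs //; try lia.
by exists (x :: t); rewrite -cat_rcons.
Qed.

(** * A vertex that sees three colors, and an edge of the fourth color [k] *)

Section Star.

Variables (v : T) (k : 'I_4).

Let star a b d := [&& v != a, v != b, v != d & uniq [:: k; c v a; c v b; c v d]].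

Lemma star_uniq a b d : star a b d ->
  uniq [:: v; a; b; d] /\ uniq [:: c v a; c v b; c v d; k].
Proof.
case/and4P=> va vb vd uk; split; last by rewrite -(rot_uniq 3).
move: uk; rewrite /= !inE !negb_or va vb vd /= !andbT.
case/and3P=> _ /andP[ab ad] bd; apply/andP; split; first (apply/andP; split).
- by apply: contraNneq ab => ->.
- by apply: contraNneq ad => ->.
by apply: contraNneq bd => ->.
Qed.

Lemma starAC a b d : star a b d -> star a d b.
Proof.
case/and4P=> va vb vd uk; apply/and4P; split=> //; apply: etrans uk.
apply: perm_uniq; rewrite (perm_cat2l [:: k; c v a]).
exact: permEl (perm_catC [:: c v d] [:: c v b]).
Qed.

Lemma starCA a b d : star a b d -> star b a d.
Proof.
case/and4P=> va vb vd uk; apply/and4P; split=> //; apply: etrans uk.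
apply: perm_uniq; rewrite (perm_cat2l [:: k]).
rewrite (perm_cat2r [:: c v d] [:: c v b; c v a] [:: c v a; c v b]).
exact: permEl (perm_catC [:: c v b] [:: c v a]).
Qed.

Lemma star_inner_edge a b d : star a b d -> c a b = k -> has_mono_pineapple c.
Proof.
case/star_uniq => us uk ck; have [t [ut st]] := complete_frame us isT.
by apply: (frame_pineapple (v0 := v) (e := (1, 2)) st ut) => //=; rewrite ck.
Qed.

Lemma star_leaf_edge a b d y :
  star a b d -> v != y -> a != y -> c a y = k -> has_mono_pineapple c.
Proof.
move=> sabd vy ay ck; have [yb|yb] := eqVneq y b.
  by apply: (star_inner_edge sabd); rewrite -yb.
have [yd|yd] := eqVneq y d.
  by apply: (star_inner_edge (starAC sabd)); rewrite -yd.
have [us uk] := star_uniq sabd.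
have us' : uniq (rcons [:: v; a; b; d] y).
  by rewrite rcons_uniq us !inE !negb_or ![y == _]eq_sym vy ay eq_sym yb eq_sym yd.
have [t [ut st]] := complete_frame us' isT.
by apply: (frame_pineapple (v0 := v) (e := (1, 4)) st ut) => //=; rewrite ck.
Qed.

Lemma star_center_edge a b d y :
  star a b d -> v != y -> c v y = k -> has_mono_pineapple c.
Proof.
move=> sabd vy ck; have [us uk] := star_uniq sabd.
have us' : uniq (rcons [:: v; a; b; d] y).
  rewrite rcons_uniq us andbT !inE !negb_or [y == v]eq_sym vy /=.
  move: uk; rewrite -(rot_uniq 3) /= !inE !negb_or -ck => /andP[/and3P[ya yb yd] _].
  by apply/and3P; split; [apply: contraNneq ya|apply: contraNneq yb|
    apply: contraNneq yd] => ->.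
have [t [ut st]] := complete_frame us' isT.
by apply: (frame_pineapple (v0 := v) (e := (0, 4)) st ut) => //=; rewrite ck.
Qed.

Lemma star_pineapple a b d x y :
  star a b d -> x != y -> c x y = k -> has_mono_pineapple c.
Proof.
move=> sabd xy ck.
have sbad := starCA sabd; have sdab := starCA (starAC sabd).
(* Edges meeting the star are settled first, according to the star vertex they contain; the others
   have position (4, 5). *)
have ends z w : z != w -> c z w = k -> z \in [:: v; a; b; d] ->
    has_mono_pineapple c.
  move=> + + zs; have [-> vw cw|zv zw cw] := eqVneq z v.
    exact: star_center_edge sabd vw cw.
  have [wv|wv] := eqVneq v w.
    apply: (star_center_edge sabd (y := z)); first by rewrite eq_sym.
    by rewrite csym wv.
  move: zs; rewrite !inE (negPf zv) /= => /or3P[] /eqP za; rewrite za in zw cw.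
  - exact: star_leaf_edge sabd wv zw cw.
  - exact: star_leaf_edge sbad wv zw cw.
  - exact: star_leaf_edge sdab wv zw cw.
have [xs|xs] := boolP (x \in [:: v; a; b; d]); first exact: ends xy ck xs.
have [ys|ys] := boolP (y \in [:: v; a; b; d]).
  by apply: (ends y x) => //; [rewrite eq_sym|rewrite csym].
have [us uk] := star_uniq sabd.
have us' : uniq (rcons (rcons [:: v; a; b; d] x) y).
  by rewrite !rcons_uniq us xs mem_rcons in_cons [y == x]eq_sym (negPf xy) ys.
have [t [ut st]] := complete_frame us' isT.
by apply: (frame_pineapple (v0 := v) (e := (4, 5)) st ut) => //=; rewrite ck.
Qed.

End Star.

Lemma three_colored_vertex v k1 k2 k3 : uniq [:: k1; k2; k3] ->
  sees c v k1 -> sees c v k2 -> sees c v k3 -> has_mono_pineapple c.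
Proof.
move=> uk /existsP[a /andP[va /eqP ca]] /existsP[b /andP[vb /eqP cb]].
case/existsP=> d /andP[vd /eqP cd].
have [k kk] : exists k, k \notin [:: k1; k2; k3].
  by apply: exists_notin; rewrite card_ord.
have [x [y [xy cxy]]] := every k.
apply: (@star_pineapple v k a b d x y) => //.
by rewrite va vb vd ca cb cd /= kk.
Qed.

(** * Colorings in which every vertex sees at most two colors *)

Lemma common_color (x y : T) : exists2 k, sees c x k & sees c y k.
Proof.
have [->|xy] := eqVneq x y.
  have [z] := @fresh [:: y] isT; rewrite inE eq_sym => yz.
  by exists (c y z); apply: seesP.
by exists (c x y); [apply: seesP|rewrite csym; apply: seesP; rewrite eq_sym].
Qed.

Lemma seen (k : 'I_4) : exists v, sees c v k.
Proof. by have [x [y [xy <-]]] := every k; exists x; apply: seesP. Qed.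

Lemma upper_bound : has_mono_pineapple c.
Proof.
apply: NNPP => noP.
have two v i j k : i != j -> sees c v i -> sees c v j -> sees c v k ->
    k = i \/ k = j.
  move=> ij vi vj vk; apply: NNPP => kij; apply: noP.
  apply: (three_colored_vertex _ vi vj vk).
  rewrite /= !inE !negb_or ij andbT; apply/andP; split;
    by apply/eqP=> ek; case: kij; rewrite ek; auto.
(* A vertex not seeing [q] would share [j1], [j2] and [j3] with the three given vertices, and so see
   three colors. *)
have center q j1 j2 j3 v1 v2 v3 : uniq [:: q; j1; j2; j3] ->
    sees c v1 q -> sees c v1 j1 -> sees c v2 q -> sees c v2 j2 ->
    sees c v3 q -> sees c v3 j3 -> has_mono_pineapple c.
  move=> uq v1q v1j v2q v2j v3q v3j.
  have [/andP[q1 /andP[q2 q3]] j12 j13 j23] : [/\ [&& q != j1, q != j2 & q != j3],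
      j1 != j2, j1 != j3 & j2 != j3].
    move: uq; rewrite /= !inE !negb_or -!andbA andbT.
    by case/and5P=> -> -> -> -> /andP[-> ->].
  have seesq z : sees c z q.
    apply: NNPP => zq.
    have other v j : q != j -> sees c v q -> sees c v j -> sees c z j.
      move=> qj vq vj; have [k zk vk] := common_color z v.
      by case: (two v q j k qj vq vj vk) => ek; rewrite ek in zk.
    apply: noP; apply: (@three_colored_vertex z j1 j2 j3).
    - by case/andP: uq.
    - exact: other v1q v1j.
    - exact: other v2q v2j.
    - exact: other v3q v3j.
  apply: (dominant_pineapple csym uq) => //; last exact: seen.
  move=> v i j iq jq vi vj; have [//|ij] := eqVneq i j.
  by case: (two v i j q ij vi vj (seesq v)) => e; move: iq jq; rewrite -e eqxx.
(* A color common to a vertex seeing [ord0] and one seeing [ord_max] differs from at least one of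
   these two. *)
have [v [k1 [k2 [k12 vk1 vk2]]]] : exists v k1 k2,
    [/\ k1 != k2, sees c v k1 & sees c v k2].
  have [x xk] := seen ord0; have [y yk] := seen ord_max.
  have [k zk wk] := common_color x y; have [k0|k0] := eqVneq k ord0.
    by exists y, k, ord_max; rewrite k0 in wk *.
  by exists x, k, ord0.
have [k3 k3P] : exists k, k \notin [:: k1; k2].
  by apply: exists_notin; rewrite card_ord.
have [k4 k4P] : exists k, k \notin [:: k3; k1; k2].
  by apply: exists_notin; rewrite card_ord.
have u21 : uniq [:: k2; k1; k3; k4].
  have : uniq [:: k4; k3; k1; k2] by rewrite cons_uniq k4P cons_uniq k3P /= inE k12.
  by rewrite -rev_uniq.
have u12 : uniq [:: k1; k2; k3; k4].
  apply: etrans u21; apply: perm_uniq; rewrite (perm_cat2r [:: k3; k4] [:: k1; k2] [:: k2; k1]).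
  exact: permEl (perm_catC [:: k1] [:: k2]).
have [u uk3] := seen k3; have [w wk4] := seen k4.
have [i ui wi] := common_color u w.
have [l vl ul] := common_color v u; have [m vm wm] := common_color v w.
have [k13 k14 k23 k24 k34] : [/\ k1 != k3, k1 != k4, k2 != k3, k2 != k4 & k3 != k4].
  move: u21; rewrite /= !inE !negb_or -!andbA andbT.
  by case/and5P=> _ -> -> -> /andP[-> ->].
(* If [l] and [m] agree, this color is the center; otherwise [u] and [w] see the disjoint pairs {l,
   k3} and {m, k4}, although they share [i]. *)
case: (two v k1 k2 l k12 vk1 vk2 vl) => el; rewrite el in ul;
  case: (two v k1 k2 m k12 vk1 vk2 vm) => em; rewrite em in wm.
- by apply: noP; apply: (center k1 k2 k3 k4 v u w).
- case: (two u k1 k3 i k13 ul uk3 ui) => ei; rewrite ei in wi;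
    by case: (two w k2 k4 _ k24 wm wk4 wi) => e; move: k12 k14 k23 k34; rewrite e eqxx.
- case: (two u k2 k3 i k23 ul uk3 ui) => ei; rewrite ei in wi;
    by case: (two w k1 k4 _ k14 wm wk4 wi) => e; move: k12 k24 k13 k34; rewrite e eqxx.
- by apply: noP; apply: (center k2 k1 k3 k4 v u w).
Qed.

End UpperBound.

(** * From sequences and cliques to copies of graphs *)

Lemma edgesP (G : sgraph) (e : {set G}) :
  reflect (exists x y : G, adj x y /\ e = [set x; y]) (e \in edges G).
Proof.
rewrite inE; apply: (iffP existsP) => [[x /existsP[y /andP[xy /eqP->]]]|].
  by exists x, y.
by case=> x [y [xy ->]]; exists x; apply/existsP; exists y; rewrite xy eqxx.
Qed.

Lemma path_edgeP m (e : {set path_graph m}) : e \in edges (path_graph m) ->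
  exists x y : 'I_m, y = x.+1 :> nat /\ e = [set x; y].
Proof.
case/edgesP=> x [y [/orP[]/eqP xy ->]]; first by exists x, y.
by exists y, x; rewrite setUC.
Qed.

Lemma imset_set2 (T U : finType) (f : T -> U) x y :
  f @: [set x; y] = [set f x; f y].
Proof. by rewrite imsetU1 imset_set1. Qed.

Lemma nth_path_colors (T C : Type) (c : T -> T -> C) (s : seq T) x0 k0 i :
  i.+1 < size s -> nth k0 (path_colors c s) i = c (nth x0 s i) (nth x0 s i.+1).
Proof. by case: s => //= x s si; rewrite (nth_pairmap x0). Qed.

Section Copies.

Variables (k n : nat) (c : {set complete_graph n} -> 'I_k).
Let col (x y : 'I_n) := c [set x; y].

Lemma rainbow_copy_of_path : has_rainbow_path col ->
  has_rainbow_copy c (path_graph 5).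
Proof.
case=> -[|x0 s'] [] // s5 us ucol; set s := x0 :: s' in s5 us ucol.
pose f (i : 'I_5) := nth x0 s i.
have fI : injective f.
  move=> i j /eqP; rewrite /f nth_uniq ?s5 //.
  by move/eqP/val_inj.
exists f; first split=> // x y xy.
  by rewrite /= /complete_rel (inj_eq fI); apply: contraTneq xy => ->; rewrite adj_irr.
(* The smaller endpoint of a path edge is the index of its color in the list. *)
have colors (e : {set path_graph 5}) (x y : 'I_5) : y = x.+1 :> nat ->
    e = [set x; y] -> c (f @: e) = nth (col x0 x0) (path_colors col s) x.
  move=> yx ->; rewrite imset_set2 (nth_path_colors _ x0) -yx ?s5 //.
move=> e1 e2 /path_edgeP[x1 [y1 [xy1 e1E]]] /path_edgeP[x2 [y2 [xy2 e2E]]].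
rewrite (colors _ _ _ xy1 e1E) (colors _ _ _ xy2 e2E) => /eqP.
have sc : size (path_colors col s) = 4 by rewrite /= size_pairmap; case: s5.
have x14 : x1 < 4 by have := ltn_ord y1; rewrite xy1.
have x24 : x2 < 4 by have := ltn_ord y2; rewrite xy2.
rewrite nth_uniq ?sc // => /eqP x12.
rewrite e1E e2E; congr [set _; _]; apply: val_inj => //=.
by rewrite xy1 xy2 x12.
Qed.

Lemma mono_copy_of_pineapple : has_mono_pineapple col ->
  has_monochromatic_copy c (pineapple 6 5).
Proof.
case=> l [Q [u [w [Q5 cQ uQ wQ cuw]]]].
(* The list follows the numbering of the pineapple: attaching vertex 0 first, pendent vertex 5
   last. *)
pose s := u :: rcons (enum (Q :\ u)) w.
have s6 : size s = 6.
  rewrite /= size_rcons -cardE;  have := cardsD1 u Q; rewrite uQ Q5; lia.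
have wu : w != u by apply: contraNneq wQ => ->.
have us : uniq s.
  rewrite /= rcons_uniq mem_rcons inE !mem_enum !inE eqxx enum_uniq.
  by rewrite (negPf wQ) eq_sym (negPf wu) andbF.
pose f (i : 'I_6) := nth u s i.
have fI : injective f.
  by move=> i j /eqP; rewrite /f nth_uniq ?s6 // => /eqP/val_inj.
have fQ (i : 'I_6) : i < 5 -> f i \in Q.
  case: i => -[|i] // i6 /= i5; rewrite /f /= nth_rcons.
  have -> : i < size (enum (Q :\ u)) by move: s6; rewrite /= size_rcons; lia.
  have : nth u (enum (Q :\ u)) i \in enum (Q :\ u).
    by apply: mem_nth; move: s6; rewrite /= size_rcons; lia.
  by rewrite mem_enum !inE => /andP[].
have f5 (i : 'I_6) : 5 <= i -> f i = w.
  move=> i5; have -> : f i = last u s.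
    have i5' : i = 5 :> nat by have := ltn_ord i; lia.
    by rewrite (last_nth u) s6 /f i5'.
  by rewrite /= last_rcons.
have f0 (i : 'I_6) : i = 0 :> nat -> f i = u by rewrite /f => ->.
exists f; first split=> // x y xy.
  by rewrite /= /complete_rel (inj_eq fI); apply: contraTneq xy => ->; rewrite adj_irr.
exists l => e /edgesP[x [y [/andP[xy /or3P[/andP[x5 y5]|/andP[/eqP x0 y5]|/andP[/eqP y0 x5]]] ->]]];
  rewrite imset_set2.
- by apply: cQ; rewrite ?fQ // (inj_eq fI).
- by rewrite (f0 _ x0) (f5 _ y5).
- by rewrite (f0 _ y0) (f5 _ x5) setUC.
Qed.

End Copies.

(** * A coloring of K_23 avoiding both copies *)

(** Blocks of 13, 5 and 5 vertices, each numbered by the nonzero color used inside it. *)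
Definition part (x : nat) : nat := if x < 13 then 1 else if x < 18 then 2 else 3.

(* On [0, 13) color 0 is the circulant graph with connection set {1, 5, 8, 12},
   the extremal triangle-free graph for R(3, 5) = 14. *)
Definition col23 (x y : nat) : nat :=
  if part x != part y then 0
  else if (x < 13) && ((x - y) + (y - x) \in [:: 1; 5; 8; 12]) then 0 else part x.

Lemma col23_sym x y : col23 x y = col23 y x.
Proof.
rewrite /col23 eq_sym; have [yx|//] := eqVneq (part y) (part x).
rewrite addnC yx; suff -> : (x < 13) = (y < 13) by [].
by move: yx; rewrite /part; do 4?case: ifP.
Qed.

Lemma col23_lt4 x y : col23 x y < 4.
Proof. by rewrite /col23 /part; do 4?case: ifP. Qed.

Lemma col23_part x y : col23 x y != 0 -> col23 x y = part x /\ part y = part x.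
Proof.
rewrite /col23; have [->|_] := eqVneq (part x) (part y); last by rewrite eqxx.
by case: ifP; rewrite ?eqxx.
Qed.

(** The base case is [false] because the empty clique always exists. *)
Fixpoint no_clique (r : rel nat) k (s : seq nat) : bool :=
  if k is k'.+1 then all (fun x => no_clique r k' (filter (r x) s)) s else false.

Lemma no_cliqueP r k s t : no_clique r k s -> pairwise r t -> size t = k ->
  {subset t <= s} -> False.
Proof.
elim: k s t => [|k IH] s [|x t] //= /allP ns /andP[rx rt] [tk] ts.
apply: (IH _ t (ns x (ts x (mem_head x t))) rt tk) => y yt.
by rewrite mem_filter (allP rx) // ts // inE yt orbT.
Qed.

Definition color_rel k : rel nat := fun x y => (x != y) && (col23 x y == k).

(** Colors 2 and 3 do contain five-cliques, but these fill their block and leave no room for the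
    pendent vertex. *)
Lemma no_clique23 : no_clique (color_rel 0) 5 (iota 0 23) &&
                    no_clique (color_rel 1) 5 (iota 0 23).
Proof. by vm_compute. Qed.

(** The pair may be picked in either order, harmlessly since [col23] is symmetric; [ord0] is a
    default for sets not of this form. *)
Definition coloring23 (e : {set complete_graph 23}) : 'I_4 :=
  if [pick p : 'I_23 * 'I_23 | e == [set p.1; p.2]] is Some p
  then inord (col23 p.1 p.2) else ord0.

Lemma coloring23E (x y : 'I_23) : coloring23 [set x; y] = col23 x y :> nat.
Proof.
rewrite /coloring23; case: pickP => [[a b] /= /eqP e|/(_ (x, y))]; last by rewrite /= eqxx.
rewrite inordK ?col23_lt4 //.
have xab : x = a \/ x = b by apply/set2P; rewrite -e set21.
have yab : y = a \/ y = b by apply/set2P; rewrite -e set22.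
have /set2P axy : a \in [set x; y] by rewrite e set21.
have /set2P bxy : b \in [set x; y] by rewrite e set22.
case: axy bxy => [ax|ay] [bx|b_y].
- by rewrite ax bx; case: yab => ->; rewrite ?ax ?bx.
- by rewrite ax b_y.
- by rewrite ay bx col23_sym.
- by rewrite ay b_y; case: xab => ->; rewrite ?ay ?b_y.
Qed.

Lemma coloring23_exact : exact_coloring coloring23.
Proof.
have edge (x y : nat) (k : 'I_4) : x < 23 -> y < 23 -> x != y -> col23 x y = k ->
    exists2 e, e \in edges (complete_graph 23) & coloring23 e = k.
  move=> x23 y23 xy ck; exists [set Ordinal x23; Ordinal y23].
    by apply/edgesP; exists (Ordinal x23), (Ordinal y23).
  by apply: val_inj; rewrite /= coloring23E.
move=> [[|[|[|[|//]]]] k4].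
- exact: (edge 0 1).
- exact: (edge 0 2).
- exact: (edge 13 14).
- exact: (edge 18 19).
Qed.

(** Two consecutive edges of nonzero color stay in one block and share its color. So color 0 occurs
    among the first two edges and again among the last two. *)
Lemma coloring23_no_rainbow : ~ has_rainbow_copy coloring23 (path_graph 5).
Proof.
case=> f [fI fadj] rb.
pose v i : 'I_5 := inord i.
pose d i := col23 (f (v i)) (f (v i.+1)).
have vE i : i < 5 -> v i = i :> nat by move=> i5; rewrite inordK.
have d_inj i j : i < j -> j < 4 -> d i != d j.
  move=> ij j4; have edge l : l < 4 -> [set v l; v l.+1] \in edges (path_graph 5).
    move=> l4; apply/edgesP; exists (v l), (v l.+1); split=> //.
    by rewrite /= /path_rel !vE ?eqxx //; lia.
  apply/negP=> /eqP dij.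
  have /rb : coloring23 (f @: [set v i; v i.+1]) = coloring23 (f @: [set v j; v j.+1]).
    by apply: val_inj; rewrite !imset_set2 /= !coloring23E.
  move=> /(_ (edge i (ltn_trans ij j4)) (edge j j4)) e.
  have : v i \in [set v j; v j.+1] by rewrite -e set21.
  by case/set2P=> /(congr1 val) /=; rewrite !vE; lia.
have zero i : i < 3 -> d i = 0 \/ d i.+1 = 0.
  move=> i3; have [|di] := eqVneq (d i) 0; first by left.
  have [|di'] := eqVneq (d i.+1) 0; first by right.
  have [e1 p1] := col23_part di; have [e2 p2] := col23_part di'.
  by have := d_inj i i.+1 (ltnSn i) i3; rewrite /d e1 e2 p1 eqxx.
have [d1|d1] := zero 0 isT; have [d2|d2] := zero 2 isT.
- by have := d_inj 0 2 isT isT; rewrite d1 d2.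
- by have := d_inj 0 3 isT isT; rewrite d1 d2.
- by have := d_inj 1 2 isT isT; rewrite d1 d2.
- by have := d_inj 1 3 isT isT; rewrite d1 d2.
Qed.

(** Colors 0 and 1 have no five-clique. In color 2 or 3, all neighbors of the attaching vertex share
    its block, which would put six vertices into a block of five. *)
Lemma coloring23_no_mono :
  ~ has_monochromatic_copy coloring23 (pineapple 6 5).
Proof.
case=> f [fI fadj] [k mono].
pose v i : 'I_6 := inord i.
have vE i : i < 6 -> v i = i :> nat by move=> i5; rewrite inordK.
pose g i := f (v i) : nat.
have gcol i j : i < 6 -> j < 6 -> adj (v i : pineapple 6 5) (v j) ->
    col23 (g i) (g j) = k.
  move=> i6 j6 aij; rewrite -coloring23E -imset_set2; congr val; apply: mono.
  by apply/edgesP; exists (v i), (v j).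
have g_inj i j : i < 6 -> j < 6 -> i != j -> g i != g j.
  move=> i6 j6; apply: contraNneq => /val_inj/fI/(congr1 val) /=.
  by rewrite !vE // => ->.
have clique i j : i < 5 -> j < 5 -> i != j -> col23 (g i) (g j) = k.
  move=> i5 j5 ij; apply: gcol; rewrite ?(ltn_trans _ (ltnSn 5)) //.
  by rewrite /= /pineapple_rel -(inj_eq val_inj) /= !vE ?ij ?i5 ?j5 //; lia.
have [k1|k1] := leqP k 1.
  have nc : no_clique (color_rel k) 5 (iota 0 23).
    have /andP[nc0 nc1] := no_clique23; have [->|kn0] := eqVneq (k : nat) 0.
      exact: nc0.
    have -> : k = 1 :> nat by lia.
    exact: nc1.
  apply: (no_cliqueP nc (t := map g (iota 0 5))) => //.
    rewrite pairwise_map.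
    have : pairwise [rel i j | [&& i < 5, j < 5 & i != j]] (iota 0 5) by [].
    apply: sub_pairwise => i j /and3P[i5 j5 ij] /=.
    by rewrite /color_rel clique // eqxx andbT g_inj // ltnW.
  by move=> _ /mapP[i _ ->]; rewrite mem_iota ltn_ord.
have kn0 : k != 0 :> nat by lia.
have part_k i : i < 6 -> part (g i) = k.
  case: i => [|i] i6.
    have c01 := clique 0 1 isT isT isT.
    by have [|<- _] := @col23_part (g 0) (g 1); rewrite c01.
  have c0i : col23 (g 0) (g i.+1) = k.
    apply: gcol => //; rewrite /= /pineapple_rel -(inj_eq val_inj) /= !vE //=; lia.
  by have [|e1 ->] := @col23_part (g 0) (g i.+1); rewrite -?e1 c0i.
have ug : uniq (map g (iota 0 6)).
  rewrite map_inj_in_uniq ?iota_uniq // => i j; rewrite !mem_iota => i6 j6 gij.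
  by apply: contraTeq isT => /(g_inj i j i6 j6); rewrite gij eqxx.
have [s s5 sub] : exists2 s : seq nat, size s = 5 &
    forall i, i < 6 -> g i \in s.
  exists (if k == 2 :> nat then iota 13 5 else iota 18 5); first by case: ifP.
  move=> i i6; have := part_k i i6; have := ltn_ord (f (v i)); rewrite -/(g i).
  by rewrite /part; case: eqVneq => k2; rewrite mem_iota; do 2?case: ifP; lia.
have : size (map g (iota 0 6)) <= size s.
  apply: uniq_leq_size ug _ => _ /mapP[i + ->]; rewrite mem_iota; exact: sub.
by rewrite s5.
Qed.

Theorem theorem4p3 :
  is_gallai_ramsey 4 (path_graph 5) (pineapple 6 5) 24.
Proof.
split; first split=> // n n24 c cex.
  pose col (x y : 'I_n) := c [set x; y].
  have [rb|norb] := classic (has_rainbow_path col).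
    by left; apply: rainbow_copy_of_path.
  right; apply: mono_copy_of_pineapple; apply: upper_bound norb _.
  - by move=> x y; rewrite /col setUC.
  - by rewrite card_ord.
  move=> k; have [e /edgesP[x [y [xy ->]]] <-] := cex k.
  by exists x, y.
(* A bound below 24 covers all larger orders, in particular 23. *)
move=> M [_ bound]; rewrite leqNgt; apply/negP=> M24.
case: (bound 23 M24 coloring23 coloring23_exact).
  exact: coloring23_no_rainbow.
exact: coloring23_no_mono.
Qed.
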